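(* Let $p>2$ be a non-palindromic prime and write $$p=\sum_{n=0}^{t-1}s_n2^n,\quad s_0=s_{t-1}=1,\ s_1,\ldots,s_{t-2}\in\{0,1\}.$$ Let $q=\sum_{n=0}^{t-1}s_{t-1-n}2^n$ be the reverse of $p$, and let $T$ be a positive integer with $$T\equiv 0 \bmod \mathrm{ord}_q(2)\quad\mbox{and}\quad T\not\equiv 0\bmod \mathrm{ord}_p(2).$$ Then the $T$-periodic binary sequence $\mathcal{S}$ with initial vector $$\mathcal{S}_T=(s_0,s_1,\ldots,s_{t-1},0,0,\ldots,0)$$ (of length $T$) satisfies $$\lambda(\mathcal{S})=\lambda^{sym}(\mathcal{S})+\log_2(q)=\log_2(2^T-1).$$
   Context: A binary sequence $\mathcal{S}=(s_n)_{n=0}^\infty$, $s_n\in\{0,1\}$, is $T$-periodic if $s_{n+T}=s_n$ for all $n\ge 0$ ($T$ need not be the least period); it is determined by its initial vector $\mathcal{S}_T=(s_0,\ldots,s_{T-1})$. Put $S_T(x)=\sum_{n=0}^{T-1}s_nx^n$. The 2-adic complexity of $\mathcal{S}$ (with respect to the period $T$) is $$\lambda(\mathcal{S})=\log_2\left(\frac{2^T-1}{\gcd(2^T-1,S_T(2))}\right).$$ The reverse sequence $\mathcal{S}^{rev}$ is the $T$-periodic sequence with initial vector $(s_{T-1},s_{T-2},\ldots,s_0)$, and the symmetric 2-adic complexity is $\lambda^{sym}(\mathcal{S})=\min\{\lambda(\mathcal{S}),\lambda(\mathcal{S}^{rev})\}$. An odd integer $p=\sum_{n=0}^{t-1}s_n2^n$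 with $s_0=s_{t-1}=1$ and $s_n\in\{0,1\}$ is called palindromic if it equals its reverse $q=\sum_{n=0}^{t-1}s_{t-1-n}2^n$. For an odd integer $m>1$, $\mathrm{ord}_m(2)$ denotes the order of $2$ modulo $m$, i.e. the smallest positive integer $o$ with $2^o\equiv 1\bmod m$. *)

(* Defs.v *)
From HB Require Import structures.
From mathcomp Require Import all_boot all_order all_algebra.
From mathcomp Require Import cyclic.
From mathcomp Require Import reals topology normedtype exp.

Set Implicit Arguments.
Unset Strict Implicit.
Unset Printing Implicit Defensive.

Import Order.TTheory GRing.Theory Num.Theory.

Definition seq_periodic (T : nat) (u : nat -> bool) : Prop :=
  forall n, u (n + T) = u n.

Definition seq_poly (T : nat) (u : nat -> bool) (x : nat) : nat :=
  \sum_(n < T) u n * x ^ n.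

Definition vec_rev (t : nat) (s : nat -> bool) : nat -> bool :=
  fun n => s (t.-1 - n).

Definition seq_rev (T : nat) (u : nat -> bool) : nat -> bool :=
  fun n => vec_rev T u (n %% T).

(* Only s_0, ..., s_(t-1) are constrained: s is used as a vector of length t. *)
Definition binary_expansion (p t : nat) (s : nat -> bool) : Prop :=
  [/\ 0 < t, s 0 = true, s t.-1 = true & p = \sum_(n < t) s n * 2 ^ n].

Definition bin_rev (t : nat) (s : nat -> bool) : nat :=
  \sum_(n < t) vec_rev t s n * 2 ^ n.

Definition palindromic (p : nat) : Prop :=
  exists t s, binary_expansion p t s /\ p = bin_rev t s.

Lemma ord2_exists (m : nat) :
  exists o, (0 < o) && (odd m ==> (2 ^ o == 1 %[mod m])).
Proof.
case: (boolP (odd m)) => [om|_]; last by exists 1.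
have m0 : 0 < m by case: m om.
exists (totient m); rewrite totient_gt0 m0 /=.
by apply/eqP/Euler_exp_totient; rewrite coprime2n.
Qed.

(* The order of 2 modulo an odd m; the junk value 1 for even m. *)
Definition ord2 (m : nat) : nat := ex_minn (ord2_exists m).

Local Open Scope ring_scope.

Definition log2 (R : realType) (x : R) : R := ln x / ln 2.

Definition complexity (R : realType) (T : nat) (u : nat -> bool) : R :=
  log2 ((2 ^ T - 1)%N%:R / (gcdn (2 ^ T - 1) (seq_poly T u 2))%:R).

Definition sym_complexity (R : realType) (T : nat) (u : nat -> bool) : R :=
  Num.min (complexity R T u) (complexity R T (seq_rev T u)).

(* Main.v *)
(* With N = 2^T - 1, the sequence and its reverse satisfy S_T(2) = p and
   S^rev_T(2) = 2^(T-t) q, since q | N forces t <= T.  The prime p does not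
   divide N, so gcd(N, S_T(2)) = 1, while gcd(N, 2^(T-t) q) = q because N is
   odd. *)
Require Import Defs.
From HB Require Import structures.
From mathcomp Require Import all_boot all_order all_algebra.
From mathcomp Require Import reals topology normedtype exp.

Set Implicit Arguments.
Unset Strict Implicit.
Unset Printing Implicit Defensive.

Import Order.TTheory GRing.Theory Num.Theory.
Local Open Scope ring_scope.

Lemma exp2_modn_dvd (m o T : nat) :
  (2 ^ o = 1 %[mod m])%N -> (o %| T)%N -> (2 ^ T = 1 %[mod m])%N.
Proof. by move=> Ho /dvdnP[k ->]; rewrite mulnC expnM -modnXm Ho modnXm exp1n. Qed.

(** For odd [m] the predicate minimised in [ord2] is the true order condition. If 2^T is 1 modulo
    [m], so is 2^r for the remainder r of [T] modulo the order, and minimality forces r = 0. *)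
Lemma ord2P (m T : nat) : odd m -> (ord2 m %| T)%N = (m %| 2 ^ T - 1)%N.
Proof.
move=> om; rewrite -eqn_mod_dvd ?expn_gt0 // /ord2.
case: ex_minnP => o; rewrite om /= => /andP[o_gt0 /eqP Ho] o_min.
apply/idP/eqP => [|HT]; first exact: exp2_modn_dvd Ho.
have Hr : (2 ^ (T %% o) = 1 %[mod m])%N.
  move: HT; rewrite {1}(divn_eq T o) expnD -modnMml.
  by rewrite (exp2_modn_dvd Ho (dvdn_mull _ (dvdnn o))) modnMml mul1n.
case: (posnP (T %% o)) => [/eqP //|r_gt0].
have := o_min (T %% o)%N; rewrite r_gt0 Hr eqxx /= => /(_ isT).
by rewrite leqNgt ltn_mod o_gt0.
Qed.

(** Reindexing by n -> t-1-n moves the reversal from the digits to the weights, so that zero padding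
    of [s] can be removed by [sum_pad]. *)
Lemma bin_revE (t : nat) (s : nat -> bool) :
  bin_rev t s = (\sum_(n < t) s n * 2 ^ (t.-1 - n))%N.
Proof.
rewrite /bin_rev (reindex_inj rev_ord_inj) /=.
apply: eq_bigr => -[n ltnt] _ /=; rewrite /vec_rev.
have -> : (t - n.+1 = t.-1 - n)%N by rewrite -subn1 -subnDA add1n.
by rewrite subKn // -ltnS prednK // (leq_ltn_trans _ ltnt).
Qed.

(** The units digit of the reverse is s_(t-1), and every other term carries a factor 2. *)
Lemma odd_bin_rev (t : nat) (s : nat -> bool) :
  (0 < t)%N -> s t.-1 -> odd (bin_rev t s).
Proof.
case: t => // t _ /= st; rewrite /bin_rev big_ord_recl /vec_rev subn0 st oddD.
rewrite -[odd (\sum_(_ < _) _)]negbK -dvdn2 dvdn_sum // => n _.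
by rewrite dvdn_mull // expnS dvdn_mulr.
Qed.

(** The digit s_0 becomes the leading digit of the reverse. *)
Lemma bin_rev_ge (t : nat) (s : nat -> bool) :
  (0 < t)%N -> s 0%N -> (2 ^ t.-1 <= bin_rev t s)%N.
Proof.
by case: t => // t _ s0; rewrite bin_revE big_ord_recl /= s0 mul1n subn0 leq_addr.
Qed.

(** The weight [F] is left general to cover both 2^n, for the sequence, and 2^(T-1-n), for its
    reverse. *)
Lemma sum_pad (t T : nat) (s u : nat -> bool) (F : nat -> nat) :
  (t <= T)%N ->
  (forall n, (n < T)%N -> u n = if (n < t)%N then s n else false) ->
  (\sum_(n < T) u n * F n = \sum_(n < t) s n * F n)%N.
Proof.
move=> letT uE; rewrite (big_ord_widen T (fun n => s n * F n)%N letT).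
rewrite [RHS]big_mkcond; apply: eq_bigr => n _ /=.
by rewrite uE //; case: ifP.
Qed.

(** Reversal brings the T-t padding zeros to the low positions, which shifts the reversed digits by
    T-t places. *)
Lemma seq_poly_rev (t T : nat) (s u : nat -> bool) :
  (t <= T)%N ->
  (forall n, (n < T)%N -> u n = if (n < t)%N then s n else false) ->
  seq_poly T (seq_rev T u) 2 = (2 ^ (T - t) * bin_rev t s)%N.
Proof.
move=> letT uE.
have -> : seq_poly T (seq_rev T u) 2 = bin_rev T u.
  by apply: eq_bigr => n _; rewrite /seq_rev modn_small.
rewrite !bin_revE (sum_pad (fun n => 2 ^ (T.-1 - n))%N letT uE) big_distrr /=.
apply: eq_bigr => -[n ltnt] _ /=; rewrite mulnCA -expnD; congr (_ * 2 ^ _)%N.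
(* What remains is T-1-n = (T-t) + (t-1-n); writing [t] and [T] as successors removes the truncated
   predecessors. *)
case: t {uE} letT ltnt => // t letT; rewrite ltnS => lent.
case: T letT => // T; rewrite ltnS => letT.
by rewrite subSS /= addnBA // subnK.
Qed.

Lemma log2M (R : realType) (x y : R) :
  0 < x -> 0 < y -> log2 (x * y) = log2 x + log2 y.
Proof. by move=> x0 y0; rewrite /log2 lnM ?posrE // mulrDl. Qed.

Lemma log2_ge0 (R : realType) (x : R) : 1 <= x -> 0 <= log2 x.
Proof. by move=> x1; rewrite divr_ge0 // ln_ge0 // ler1n. Qed.

Theorem theorem1 (R : realType) (p t q T : nat) (s u : nat -> bool)
  (p_prime : prime p) (p_gt2 : (2 < p)%N) (p_nonpal : ~ palindromic p)
  (p_exp : binary_expansion p t s)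
  (q_rev : q = bin_rev t s)
  (T_gt0 : (0 < T)%N)
  (T_ordq : (ord2 q %| T)%N) (T_ordp : ~~ (ord2 p %| T)%N)
  (u_per : seq_periodic T u)
  (u_init : forall n : nat, (n < T)%N -> u n = (if (n < t)%N then s n else false)) :
  complexity R T u = sym_complexity R T u + log2 (q%:R : R) /\
  sym_complexity R T u + log2 (q%:R : R) = log2 ((2 ^ T - 1)%N%:R : R).
Proof.
case: p_exp => t_gt0 s0 st pE.
have q_odd : odd q by rewrite q_rev odd_bin_rev.
have p_odd : odd p by case: (even_prime p_prime) p_gt2 => [->|].
rewrite ord2P // in T_ordq; rewrite ord2P // in T_ordp.
have q_gt0 : (0 < q)%N by apply: odd_gt0.
have N_gt0 : (0 < 2 ^ T - 1)%N by rewrite subn_gt0 -{1}(expn0 2) ltn_exp2l.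
(* Compare exponents in 2^(t-1) <= q <= 2^T - 1 < 2^T. *)
have letT : (t <= T)%N.
  rewrite -(prednK t_gt0) -(ltn_exp2l _ _ (isT : 1 < 2)%N).
  apply: leq_ltn_trans (bin_rev_ge t_gt0 s0) _; rewrite -q_rev.
  by apply: leq_ltn_trans (dvdn_leq N_gt0 T_ordq) _; rewrite subn1 ltn_predL expn_gt0.
have cop2 : coprime (2 ^ T - 1) (2 ^ (T - t)).
  rewrite coprimeXr // coprimen2 oddB ?expn_gt0 // oddX.
  by rewrite orbF eqn0Ngt T_gt0.
have cE : complexity R T u = log2 (2 ^ T - 1)%N%:R.
  rewrite /complexity /seq_poly (sum_pad (expn 2) letT u_init) -pE.
  have /eqP-> : coprime (2 ^ T - 1) p by rewrite coprime_sym prime_coprime.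
  by rewrite divr1.
have crE : complexity R T (seq_rev T u) + log2 q%:R = log2 (2 ^ T - 1)%N%:R.
  rewrite /complexity (seq_poly_rev letT u_init) -q_rev Gauss_gcdr //.
  rewrite (gcdn_idPr T_ordq) -log2M ?divr_gt0 ?ltr0n // divfK //.
  by rewrite pnatr_eq0 -lt0n.
(* The two complexities differ by log2 q, which is nonnegative as q >= 1, so the minimum is attained
   by the reverse sequence. *)
suff -> : sym_complexity R T u = complexity R T (seq_rev T u) by rewrite crE.
by apply/min_idPr; rewrite cE -crE lerDl log2_ge0 // ler1n.
Qed.
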